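(* (1) If $A\in C_1$ and $a\in A\setminus E_1$, then $\bar d(A)\le \frac{a-1}{2a}$. (2) If $A\in C_2$ and $a\in A\setminus E_2$, then $\bar d(A)\le \frac{4a-2}{6a}$. (3) If $A\in C_3$ and $a\in A\setminus E_3$, then $\bar d(A)\le \frac{22a-4}{30a}$.
   Context: Let $\mathbb{Z}^{+}$ be the set of positive integers and $p_i$ the $i$th prime. $C_k$ is the family of all subsets $A\subseteq\mathbb{Z}^{+}$ that do not contain $k+1$ pairwise coprime integers. $E_k$ is the set of positive integers divisible by at least one of $p_1,\ldots,p_k$. For $A\subseteq\mathbb{Z}^{+}$, $A(n)=A\cap\{1,\ldots,n\}$, $|A(n)|$ is its number of elements, and the upper density is $\bar d(A)=\limsup_{n\to\infty}|A(n)|/n$.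
   Formalization: Parts (2) and (3) are stated for a > 1 only: with k+1 distinct pairwise coprime integers they fail at a = 1, e.g. A = {1} together with the even numbers is in C_2 and has density 1/2 > 1/3. *)

(* Defs.v *)
From mathcomp Require Import all_boot all_order all_algebra finmap.
From mathcomp Require Import all_classical all_reals all_analysis.

Set Implicit Arguments.
Unset Strict Implicit.
Unset Printing Implicit Defensive.

Import Order.TTheory GRing.Theory Num.Theory.

Local Open Scope classical_set_scope.
Local Open Scope ring_scope.

Definition pos_nat : set nat := [set m | (0 < m)%N].

Lemma ex_prime_gt (m : nat) : exists p, (m < p)%N && prime p.
Proof. by have [p mp pp] := prime_above m; exists p; apply/andP. Qed.

(* Least prime strictly greater than m. *)
Definition next_prime (m : nat) : nat := ex_minn (ex_prime_gt m).

(* Indexing starts at 1: nth_prime 1 = 2, nth_prime 2 = 3, nth_prime 3 = 5;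
   nth_prime 0 = 0 is a placeholder that is not a prime. *)
Definition nth_prime (i : nat) : nat := iter i next_prime 0%N.

(* The k + 1 integers are required to be distinct; as 1 is the only positive
   integer coprime to itself, this matters only for sets containing 1.
   For k >= 1, {1} together with E k (below) belongs to C k.+1. *)
Definition C (k : nat) : set (set nat) :=
  [set A | A `<=` pos_nat /\
    ~ exists s : seq nat,
        [/\ size s = k.+1, uniq s, {in s, forall x, A x} & pairwise coprime s]].

Definition E (k : nat) : set nat :=
  [set m | (0 < m)%N /\
    exists i : nat, (1 <= i <= k)%N /\ (nth_prime i %| m)%N].

Definition initial (A : set nat) (n : nat) : set nat :=
  A `&` [set m | (1 <= m <= n)%N].

(* The term of index n = 0 is 0 / 0 = 0 and does not affect the limsup. *)
Definition upper_density (R : realType) (A : set nat) : \bar R :=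
  limn_esup (fun n : nat => ((#|` fset_set (initial A n)|%:R / n%:R : R)%:E)).

(* Main.v *)
Require Import Defs.
From mathcomp Require Import all_boot all_order all_algebra finmap.
From mathcomp Require Import all_classical all_reals all_analysis.
From mathcomp Require Import zify.

(* Let M = 2, 6, 30 be the product of the first k primes and cut the integers
   into blocks M q + {2, ..., M + 1}. A prime dividing two elements of a block
   divides their difference, so it divides M as soon as the difference has no
   prime factor outside M; hence whether two such elements are coprime depends
   only on their offsets. A set of pairwise coprime integers meets A in at most
   k elements, and in at most k - 1 elements if they are all coprime to a.
   Packing disjoint sets of pairwise coprime elements into a block shows that A
   has at most h = 1, 4, 22 elements in every block. If a divides M q + t, then
   a is coprime to all M q + i with |i - t| free of primes outside M; for
   l = 1, 2, 4 suitable values of t this improves the bound to h - 1. As a is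
   coprime to M, each t occurs once in any a consecutive blocks, and the
   differences of the chosen t, being free of primes outside M, prevent two of
   them from occurring in the same block. So A has at most h a - l elements
   in a blocks, of total length M a. *)

Set Implicit Arguments.
Unset Strict Implicit.
Unset Printing Implicit Defensive.

Import Order.TTheory GRing.Theory Num.Theory.

Local Open Scope classical_set_scope.
Local Open Scope ring_scope.

(** * Packings and coprimality criteria *)

(** Members of [flatten cs] outside [P] are distinct members of [B] outside [P]; comparing
    complements gives the bound. *)
Lemma count_packing (T : eqType) (P : pred T) (B : seq T) (cs : seq (seq T)) :
  uniq (flatten cs) -> {subset flatten cs <= B} ->
  (count P B + size (flatten cs) <= size B + \sum_(c <- cs) count P c)%N.
Proof.
move=> ucs scs.
have le_pred : (count (predC P) (flatten cs) <= count (predC P) B)%N.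
  rewrite -!size_filter; apply: uniq_leq_size; first exact: filter_uniq.
  by move=> x; rewrite !mem_filter => /andP[-> /scs].
have -> : (\sum_(c <- cs) count P c = count P (flatten cs))%N.
  by rewrite count_flatten sumnE big_map.
by rewrite -(count_predC P B) -(count_predC P (flatten cs)); lia.
Qed.

Lemma coprime_primeP (m n : nat) :
  (forall p, prime p -> p %| m -> p %| n -> False)%N -> coprime m n.
Proof.
move=> no_prime; apply/negPn/negP => ncop.
have [p pp] : exists2 p, prime p & (p %| gcdn m n)%N.
  move: ncop; rewrite /coprime; case: (gcdn m n) => [_|[|g] _] //.
    (* Here the gcd is 0, which every prime divides. *)
    by exists 2%N.
  by exists (pdiv g.+2); rewrite ?pdiv_prime ?pdiv_dvd.
by rewrite dvdn_gcd => /andP[]; apply: no_prime.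
Qed.

Definition dist (i j : nat) : nat := (i - j + (j - i))%N.

Lemma dvdn_dist (d m i j : nat) :
  (d %| m + i -> d %| m + j -> d %| dist i j)%N.
Proof.
move=> di dj.
have -> : dist i j = (m + i - (m + j) + (m + j - (m + i)))%N.
  by rewrite /dist; lia.
by rewrite dvdn_add ?dvdn_sub.
Qed.

Lemma pnat_prime_dvd (M n p : nat) :
  \pi(M).-nat n -> prime p -> (p %| n -> p %| M)%N.
Proof.
move=> Mn pp pn; have := pnat_dvd pn Mn.
by rewrite pnatE // mem_primes => /and3P[].
Qed.

Definition sure_coprime (M i j : nat) : bool :=
  coprime (gcdn i j) M && \pi(M).-nat (dist i j).

Lemma sure_coprimeP (M q i j : nat) :
  sure_coprime M i j -> coprime (M * q + i) (M * q + j).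
Proof.
move=> /andP[cop_ij smooth]; apply: coprime_primeP => p pp pi pj.
have pM : (p %| M)%N := pnat_prime_dvd smooth pp (dvdn_dist pi pj).
move: pi pj; rewrite !(dvdn_addr _ (dvdn_mulr q pM)) => pi pj.
have : (p %| gcdn (gcdn i j) M)%N by rewrite !dvdn_gcd pi pj pM.
by rewrite (eqP cop_ij) dvdn1 => /eqP p1; rewrite p1 in pp.
Qed.

Lemma coprime_near_multiple (M a q i t : nat) :
  coprime a M -> (a %| M * q + t)%N -> \pi(M).-nat (dist i t) ->
  coprime (M * q + i) a.
Proof.
move=> copaM at_ smooth; apply: coprime_primeP => p pp pi pa.
have pM := pnat_prime_dvd smooth pp (dvdn_dist pi (dvdn_trans pa at_)).
have : (p %| gcdn a M)%N by rewrite dvdn_gcd pa pM.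
by rewrite (eqP copaM) dvdn1 => /eqP p1; rewrite p1 in pp.
Qed.

(** * Bounds for one block *)

Lemma count_clique (k : nat) (A : set nat) (s : seq nat) :
  C k A -> uniq s -> pairwise coprime s ->
  (count (fun x => `[< A x >]) s <= k)%N.
Proof.
move=> [_ noA] us ps; rewrite leqNgt; apply/negP => ltk; apply: noA.
set P : pred nat := fun x => `[< A x >].
have sub : subseq (take k.+1 [seq x <- s | P x]) s.
  exact: subseq_trans (take_subseq _ _) (filter_subseq P s).
exists (take k.+1 [seq x <- s | P x]); split.
- by rewrite size_takel // size_filter.
- exact: subseq_uniq sub us.
- by move=> x /mem_take; rewrite mem_filter => /andP[/asboolP].
- exact: subseq_pairwise sub ps.
Qed.

(** The element [a] enlarges the pairwise coprime family by one. The condition [1 < x] keeps [a] out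
    of [s], as only 1 is coprime to itself; this is why blocks start at offset 2. *)
Lemma count_clique_coprime (k a : nat) (A : set nat) (s : seq nat) :
  C k.+1 A -> A a -> uniq s -> pairwise coprime s ->
  all (fun x => (1 < x)%N && coprime x a) s ->
  (count (fun x => `[< A x >]) s <= k)%N.
Proof.
move=> CA Aa us ps /allP sa.
have nas : a \notin s.
  apply/negP => /sa /andP[a1]; rewrite /coprime gcdnn => /eqP a_eq1.
  by rewrite a_eq1 in a1.
have := @count_clique k.+1 A (a :: s) CA; rewrite /= nas (asboolT Aa).
apply=> //; rewrite ps andbT; apply/allP => x /sa /andP[_].
by rewrite coprime_sym.
Qed.

Definition smooth_dist (M t i : nat) : bool := \pi(M).-nat (dist i t).

(* A certificate that a block has at most [h] elements of the set: each [c] in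
   [cs] contributes at most [k], or [k - 1] when all its offsets are [close] to
   a multiple of [a]; offsets outside [cs] are counted trivially. *)
Definition packing (M k h : nat) (close : pred nat)
    (cs : seq (seq nat)) : bool :=
  [&& uniq (flatten cs), all (mem (iota 2 M)) (flatten cs),
      all (pairwise (sure_coprime M)) cs
    & (M + sumn [seq k - all close c | c <- cs] <= h + size (flatten cs))%N].

(** The parameter [close] serves two cases: [pred0] for an arbitrary block, [smooth_dist M t] for a
    block where [a] divides [M * q + t]. *)
Lemma block_bound (k M h a q : nat) (A : set nat) (close : pred nat)
    (cs : seq (seq nat)) :
  C k.+1 A -> A a -> packing M k.+1 h close cs ->
  (forall i, close i -> coprime (M * q + i) a) ->
  (count (fun x => `[< A x >]) (iota (M * q + 2) M) <= h)%N.
Proof.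
move=> CA Aa /and4P[ucs /allP incs /allP cliques size_cs] close_cop.
set P : pred nat := fun x => `[< A x >].
rewrite iotaDl count_map; set Pq := preim _ _.
have := @count_packing _ Pq (iota 2 M) cs ucs incs.
rewrite size_iota => le_count; rewrite -(leq_add2r (size (flatten cs))).
suff le_sum : (\sum_(c <- cs) count Pq c <=
    sumn [seq k.+1 - all close c | c <- cs])%N.
  by apply: leq_trans le_count (leq_trans _ size_cs); rewrite leq_add2l.
rewrite sumnE big_map big_seq [leqRHS]big_seq; apply: leq_sum => c c_cs.
have sub_c : {subset c <= flatten cs} by move=> i ic; apply/flattenP; exists c.
have uc : uniq [seq M * q + i | i <- c]%N.
  rewrite map_inj_uniq; last exact: addnI.
  (* Since [\pi(M).-nat 0] is false, [sure_coprime M] is irreflexive. *)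
  apply: pairwise_uniq (cliques c c_cs) => i.
  by rewrite /sure_coprime /dist !subnn andbF.
have pc : pairwise coprime [seq M * q + i | i <- c]%N.
  rewrite pairwise_map.
  apply: (@sub_pairwise _ (sure_coprime M)) (cliques c c_cs) => i j.
  exact: sure_coprimeP.
have -> : count Pq c = count P [seq M * q + i | i <- c]%N by rewrite count_map.
case: (boolP (all close c)) => [all_close|_]; last exact: count_clique.
rewrite subn1 /=; apply: count_clique_coprime CA Aa uc pc _.
rewrite all_map; apply/allP => i ic /=; rewrite close_cop ?andbT; last first.
  exact: (allP all_close).
by have := incs i (sub_c i ic); rewrite !inE mem_iota => /andP[? _]; lia.
Qed.

(** * Counting over periods of [a] blocks *)

Lemma count_multiples (M a t J : nat) : (0 < a)%N -> coprime a M ->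
  (J <= count (fun q => a %| M * q + t) (iota 0 (a * J)))%N.
Proof.
move=> a_gt0 copaM; elim: J => [//|J IHJ].
rewrite mulnSr iotaD count_cat -addn1 leq_add // -has_count; apply/hasP.
(* Modulo [a], [u] is the inverse of [-M], so [q = u * t] solves [M * q + t = 0]; its residue is
   then shifted into the last period. *)
have [u _] := Bezoutl M a_gt0; rewrite (eqP copaM) => a_u.
exists (a * J + (u * t) %% a)%N.
  by rewrite mem_iota add0n leq_addr ltn_add2l ltn_mod.
have ut := divn_eq (u * t) a.
have a_last : (a %| u * t %/ a * M * a)%N := dvdn_mull _ (dvdnn a).
rewrite -(dvdn_addl _ a_last).
have -> : (M * (a * J + (u * t) %% a) + t + u * t %/ a * M * a =
  a * (J * M) + t * (1 + u * M))%N by nia.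
by apply: dvdn_add; [exact: dvdn_mulr | exact: dvdn_mull].
Qed.

Lemma count_blocks (P : pred nat) (M N : nat) :
  count P (iota 2 (M * N)) =
  (\sum_(q <- iota 0 N) count P (iota (M * q + 2) M))%N.
Proof.
elim: N => [|N IHN]; first by rewrite muln0 big_nil.
rewrite mulnSr iotaD count_cat IHN -[N.+1 in RHS]addn1 iotaD big_cat big_seq1.
by rewrite [(2 + _)%N]addnC.
Qed.

(** Give each block as weight the number of listed [t] with [a] dividing [M * q + t]. Weight plus
    count is at most [h] in every block, and the weights sum to at least [size ts * J]. *)
Lemma count_periods (k M h a J : nat) (A : set nat) (cs : seq (seq nat))
    (ts : seq (nat * seq (seq nat))) :
  C k.+1 A -> A a -> (0 < a)%N -> coprime a M -> (0 < h)%N ->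
  packing M k.+1 h pred0 cs ->
  all (fun tc => packing M k.+1 h.-1 (smooth_dist M tc.1) tc.2) ts ->
  pairwise (fun t u => ~~ (a %| dist t.1 u.1)%N) ts ->
  (count (fun x => `[< A x >]) (iota 2 (M * a * J)) <= (h * a - size ts) * J)%N.
Proof.
move=> CA Aa a_gt0 copaM h_gt0 base /allP special sep.
set P : pred nat := fun x => `[< A x >].
suff : (size ts * J + count P (iota 2 (M * a * J)) <= h * a * J)%N.
  by rewrite mulnBl; lia.
rewrite -[(M * a * J)%N]mulnA count_blocks.
have le_ts : (size ts * J <=
    \sum_(q <- iota 0 (a * J)) count (fun t => a %| M * q + t.1) ts)%N.
  under eq_bigr do rewrite -sum1_count big_mkcond.
  rewrite exchange_big /=.
  under eq_bigr do rewrite -big_mkcond sum1_count.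
  have -> : (size ts * J = \sum_(t <- ts) J)%N.
    by rewrite big_const_seq count_predT iter_addn_0 mulnC.
  by apply: leq_sum => t _; exact: count_multiples.
apply: leq_trans (leq_add le_ts (leqnn _)) _.
rewrite -big_split /=.
have -> : (h * a * J = \sum_(q <- iota 0 (a * J)) h)%N.
  by rewrite big_const_seq count_predT size_iota iter_addn_0 mulnA.
apply: leq_sum => q _.
(* Two such [t] in one block would make [a] divide their distance, against [sep]. *)
have le1 : (count (fun t => a %| M * q + t.1)%N ts <= 1)%N.
  have := pairwise_filter (fun t => a %| M * q + t.1)%N sep.
  have := mem_filter (fun t => a %| M * q + t.1)%N ^~ ts.
  rewrite -size_filter; case: [seq _ <- ts | _] => [|t [|u s]] //= mem_s.
  have /andP[at_ _] : (a %| M * q + t.1)%N && (t \in ts).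
    by rewrite -mem_s !inE eqxx.
  have /andP[au _] : (a %| M * q + u.1)%N && (u \in ts).
    by rewrite -mem_s !inE eqxx orbT.
  by rewrite (dvdn_dist at_ au).
have [/hasP[t tts at_]|no_t] := boolP (has (fun t => a %| M * q + t.1)%N ts).
  have : (count P (iota (M * q + 2) M) <= h.-1)%N.
    apply: block_bound CA Aa (special t tts) _ => i.
    exact: coprime_near_multiple.
  by move: le1 h_gt0; lia.
have -> : count (fun t => a %| M * q + t.1)%N ts = 0%N.
  by apply/eqP; rewrite -leqn0 leqNgt -has_count.
by apply: block_bound CA Aa base _.
Qed.

(** * From block counts to upper density *)

Lemma card_initial_le (A : set nat) (n : nat) :
  (#|` fset_set (initial A n)| <= count (fun x => `[< A x >]) (iota 1 n))%N.
Proof.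
have fin : finite_set (initial A n).
  apply: sub_finite_set (finite_seq (iota 1 n)) => x [_ /= xn].
  by rewrite mem_iota add1n ltnS.
rewrite -size_filter; apply: uniq_leq_size; first exact: fset_uniq.
move=> x; rewrite (in_fset_set fin) inE => -[Ax /= xn].
by rewrite mem_filter mem_iota add1n ltnS xn andbT; apply/asboolP.
Qed.

Lemma upper_density_le (R : realType) (A : set nat) (L c : nat) : (0 < L)%N ->
  (forall J, count (fun x => `[< A x >]) (iota 2 (L * J)) <= c * J)%N ->
  (upper_density R A <= (c%:R / L%:R)%:E)%E.
Proof.
move=> L_gt0 bound; set P : pred nat := fun x => `[< A x >].
(* The constant is 1 for the integer 1, which precedes all blocks, plus [c] for the incomplete last
   period. *)
have le_card n : (#|` fset_set (initial A n)| <= c.+1 + c * (n %/ L))%N.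
  apply: leq_trans (card_initial_le A n) _.
  have n_lt := ltn_ceil n L_gt0.
  apply: (@leq_trans (count P (iota 1 (1 + L * (n %/ L).+1)))).
    have -> : (1 + L * (n %/ L).+1 = n + (1 + L * (n %/ L).+1 - n))%N by lia.
    by rewrite iotaD count_cat leq_addr.
  rewrite iotaD count_cat /= addn0; have := bound (n %/ L).+1.
  by rewrite -/P -[(1 + 1)%N]/2%N; move: (count P _); case: (P 1%N); lia.
apply/lee_addgt0Pr => e e_gt0.
(* Beyond [N] the constant term [c.+1] is at most [e * n]; the limsup is at most the supremum over
   this tail. *)
pose N := Num.bound (c.+1%:R / e : R).
apply: (@le_trans _ _ (ereal_sup ((fun n : nat =>
  ((#|` fset_set (initial A n)|%:R / n%:R : R)%:E)) @` [set n | (N.+1 <= n)%N]))).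
  by apply: ereal_inf_lbound; exists [set n | (N.+1 <= n)%N] => //; exists N.+1.
apply: ge_ereal_sup => _ [n /= Nn <-]; rewrite -EFinD lee_fin.
have n_gt0 : (0 < n%:R :> R) by rewrite ltr0n; lia.
have L_gt0' : (0 < L%:R :> R) by rewrite ltr0n.
rewrite ler_pdivrMr // mulrDl.
apply: (@le_trans _ _ (c.+1%:R + c%:R * (n %/ L)%:R)).
  by rewrite -natrM -natrD ler_nat.
rewrite addrC lerD //.
  rewrite -mulrA ler_wpM2l // mulrC ler_pdivlMr // -natrM ler_nat.
  exact: leq_trunc_div.
rewrite mulrC -ler_pdivrMr //; apply: ltW.
apply: (@lt_le_trans _ _ N%:R); last by rewrite ler_nat ltnW.
by apply: archi_boundP; rewrite divr_ge0 ?ltW.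
Qed.

(** A prime factor of [a] lies outside [M]. This separates the chosen [t], whose differences are
    smooth. *)
Lemma smooth_not_dvd (M a n : nat) :
  (1 < a)%N -> coprime a M -> \pi(M).-nat n -> ~~ (a %| n)%N.
Proof.
move=> a_gt1 copaM Mn; apply/negP => an.
have pa := pdiv_dvd a; have pp := pdiv_prime a_gt1.
have := pnat_prime_dvd Mn pp (dvdn_trans pa an).
by apply/negP; rewrite -prime_coprime //; apply: coprime_dvdl copaM.
Qed.

Lemma density_bound (R : realType) (k M h a : nat) (A : set nat)
    (cs : seq (seq nat)) (ts : seq (nat * seq (seq nat))) :
  C k.+1 A -> A a -> (0 < M)%N -> coprime a M -> (0 < h)%N ->
  packing M k.+1 h pred0 cs ->
  all (fun tc => packing M k.+1 h.-1 (smooth_dist M tc.1) tc.2) ts ->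
  pairwise (fun t u => ~~ (a %| dist t.1 u.1)%N) ts ->
  (upper_density R A <= ((h * a - size ts)%N%:R / (M * a)%N%:R)%:E)%E.
Proof.
move=> CA Aa M_gt0 copaM h_gt0 base special sep.
have a_gt0 : (0 < a)%N := CA.1 a Aa.
apply: upper_density_le => [|J]; first by rewrite muln_gt0 M_gt0.
exact: count_periods CA Aa a_gt0 copaM h_gt0 base special sep.
Qed.

(** * The first primes and the explicit packings *)

Lemma next_primeE (m p : nat) : prime p -> (m < p)%N ->
  (forall q, m < q < p -> ~~ prime q)%N -> next_prime m = p.
Proof.
move=> pp mp gap; rewrite /next_prime; case: ex_minnP => q /andP[mq pq] min_q.
have := min_q p; rewrite mp pp leq_eqVlt => /(_ isT) /orP[/eqP//|qp].
by have := gap q; rewrite mq qp pq => /(_ isT).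
Qed.

Lemma nth_primeE : [/\ nth_prime 1 = 2, nth_prime 2 = 3 & nth_prime 3 = 5]%N.
Proof.
have p1 : nth_prime 1 = 2%N by apply: next_primeE => // [[|[|q]]].
have p2 : nth_prime 2 = 3%N.
  rewrite /nth_prime iterS -/(nth_prime 1) p1.
  by apply: next_primeE => // [[|[|[|q]]]].
split=> //; rewrite /nth_prime iterS -/(nth_prime 2) p2.
by apply: next_primeE => // [[|[|[|[|[|q]]]]]].
Qed.

Lemma notin_E_coprime (k a : nat) (A : set nat) (i : nat) :
  C k A -> (A `\` E k) a -> (1 <= i <= k)%N -> prime (nth_prime i) ->
  coprime a (nth_prime i).
Proof.
move=> [posA _] [Aa nEa] ik pi; rewrite coprime_sym prime_coprime //.
by apply/negP => pa; apply: nEa; split; [exact: posA | exists i].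
Qed.

(** The last two bounds fail for [a = 1]: [{1}] with [E 1] is in [C 2] and has density 1/2 > 1/3;
    [{1}] with [E 2] is in [C 3] and has density 2/3 > 3/5. *)
Theorem corollary1 (R : realType) :
  [/\ forall (A : set nat) (a : nat), C 1 A -> (A `\` E 1) a ->
        (upper_density R A <= ((a%:R - 1) / (2 * a%:R))%:E)%E,
      forall (A : set nat) (a : nat), C 2 A -> (A `\` E 2) a -> (1 < a)%N ->
        (upper_density R A <= ((4 * a%:R - 2) / (6 * a%:R))%:E)%E
    & forall (A : set nat) (a : nat), C 3 A -> (A `\` E 3) a -> (1 < a)%N ->
        (upper_density R A <= ((22 * a%:R - 4) / (30 * a%:R))%:E)%E].
Proof.
have [p1 p2 p3] := nth_primeE.
split=> A a CA aA; have [Aa _] := aA; have a_gt0 : (0 < a)%N := CA.1 a Aa;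
  have cop i := notin_E_coprime (i := i) CA aA.
- have cop2 : coprime a 2 by have := cop 1%N; rewrite p1; exact.
  (* The offset 1 lies just before the block, at smooth distances 1 and 2 from its elements. *)
  have := density_bound R (M := 2) (h := 1) (cs := [:: [:: 2; 3]])
    (ts := [:: (1, [:: [:: 2; 3]])])%N CA Aa.
  by rewrite mul1n natrB // natrM; apply.
- move=> a_gt1.
  have cop6 : coprime a 6.
    rewrite (_ : 6 = 2 * 3)%N // coprimeMr; apply/andP; split.
      by have := cop 1%N; rewrite p1; exact.
    by have := cop 2%N; rewrite p2; exact.
  (* The bounds are 6 - 4 + 2 = 4 in general, 6 - 5 + 1 + 1 = 3 for [t = 4] and 6 - 4 + 1 = 3 for
     [t = 6]. *)
  have := density_bound R (M := 6) (h := 4) (cs := [:: [:: 3; 4; 5; 7]])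
    (ts := [:: (4, [:: [:: 2; 3]; [:: 5; 6; 7]]);
               (6, [:: [:: 3; 4; 5; 7]])])%N CA Aa.
  rewrite natrB ?natrM; last by rewrite /=; lia.
  by apply=> //=; rewrite (smooth_not_dvd a_gt1 cop6).
- move=> a_gt1.
  have cop30 : coprime a 30.
    rewrite (_ : 30 = 2 * 3 * 5)%N // !coprimeMr -andbA; apply/and3P; split.
    + by have := cop 1%N; rewrite p1; exact.
    + by have := cop 2%N; rewrite p2; exact.
    + by have := cop 3%N; rewrite p3; exact.
  (* In general 30 - 14 + 3 + 3 = 22. For [t = 13] all three lists are close, giving 30 - 15 + 2 + 2
     + 2 = 21; for the other [t] one list is not, giving 30 - 16 + 2 + 2 + 3 = 21. *)
  have := density_bound R (M := 30) (h := 22)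
    (cs := [:: [:: 5; 7; 8; 9; 11; 13; 17]; [:: 19; 23; 25; 27; 28; 29; 31]])
    (ts := [:: (8, [:: [:: 5; 9; 11; 13; 14; 17];
                       [:: 19; 23; 25; 27; 28; 29; 31]; [:: 2; 3; 7]]);
               (9, [:: [:: 3; 5; 7; 8; 11; 13]; [:: 19; 23; 25; 27; 28; 29; 31];
                       [:: 14; 15; 17]]);
               (13, [:: [:: 3; 5; 7; 8; 11; 23]; [:: 9; 14; 17; 19; 29];
                        [:: 16; 21; 25; 31]]);
               (14, [:: [:: 11; 13; 15; 16; 17; 19]; [:: 4; 5; 9; 29];
                        [:: 7; 22; 23; 25; 27; 31]])])%N CA Aa.
  rewrite natrB ?natrM; last by rewrite /=; lia.
  by apply=> //=; rewrite !(smooth_not_dvd a_gt1 cop30).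
Qed.
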